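(* Let $k\ge 3$ be an integer and $n$ an integer with $0\le n\le k-1$, and let $q$ tend to $-1$ within the real interval $]-1,0[$. (a) One has $\lim_{q\to-1}\gamma_{k,n}(q)=0$ if and only if $k$ is even and $k-2n\equiv 2\pmod 4$. (b) Otherwise, $\lim_{q\to-1}|\gamma_{k,n}(q)|=+\infty$. More precisely, $\lim_{q\to-1}(-1)^{k'-n'}\gamma_{k,n}(q)=+\infty$ whenever $(k,n)$ can be expressed by means of a pair of integers $(k',n')$ in one of the following manners: 1. $k=4k'$, $n=2n'$; 2. $k=4k'+2$, $n=2n'+1$; 3. $k=4k'+1$, $n\in\{2n',2n'+1\}$; 4. $k=4k'-1$, $n\in\{2n',2n'-1\}$.
   Context: For $q\in\mathbb{C}$ with $0<|q|<1$, an integer $k\ge1$ and $n\in\mathbb{Z}$, $$\gamma_{k,n}(q) := \sum_{\substack{m_1,\ldots,m_k\in\mathbb{Z}\\ m_1+\cdots+m_k=n}} q^{(m_1(m_1-1)+\cdots+m_k(m_k-1))/2};$$ equivalently, $\gamma_{k,n}(q)$ is the coefficient of $x^n$ in the Laurent expansion on $\mathbb{C}^*$ of $\theta_q(x)^k$, where $\theta_q(x):=\sum_{m\in\mathbb{Z}} q^{m(m-1)/2}x^m$. *)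

(* Defs.v *)
From mathcomp Require Import all_boot all_order all_algebra.
From mathcomp Require Import all_classical all_reals all_analysis.
From mathcomp.analysis.showcase Require summability.

Set Implicit Arguments.
Unset Strict Implicit.
Unset Printing Implicit Defensive.

Import Order.TTheory GRing.Theory Num.Theory.
Import numFieldNormedType.Exports.

Local Open Scope ring_scope.

(* [summability.sum] is the unordered sum: the limit of the finite partial sums
   along the filter of finite subsets of the index set. For K = R or C this
   family is absolutely summable when 0 < |q| < 1, so the limit exists. The
   division by 2 is exact, since each m_i (m_i - 1) is even. *)
Definition gamma (K : numFieldType) (k : nat) (n : int) (q : K) : K :=
  summability.sum
    (fun m : {m : {ffun 'I_k -> int} | \sum_(i < k) m i == n} =>
       q ^ ((\sum_(i < k) val m i * (val m i - 1)) %/ 2)%Z).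

(* Main.v *)
(** Group the coordinates of [m] in pairs [(a, b)]. If [a + b = 2 u], put
  [(a, b) = (u + v, u - v)]: the exponents add up to [u (u - 1) + v ^ 2]. If
  [a + b = 2 u + 1], put [(a, b) = (u + v, u + 1 - v)]: they add up to
  [u ^ 2 + v (v - 1)]. Hence, with [theta q = \sum_v q ^ (v ^ 2)] and
  [psi q = \sum_v q ^ (v (v - 1))],
    [gamma_(k+2, n) = theta q * \sum_u q ^ (u (u - 1)) gamma_(k, n - 2 u)
                    + psi q * \sum_u q ^ (u ^ 2) gamma_(k, n - 1 - 2 u)].
  As [q = - r] tends to [-1], [theta q] decreases faster than any power of
  [1 - r]: this follows by iterating [theta r * theta (- r) = theta (- r ^ 2) ^ 2]
  (same change of variables) with [theta r ^ 2 >= 1 / (8 (1 - r))]. All other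
  quantities are [O((1 - r) ^ - N)], so only the [psi] branch survives, and there
  [q ^ (u ^ 2) = (-1) ^ u r ^ (u ^ 2)] makes all terms have the same sign: for
  [k = 2 l + p] with [p] in [{0, 1}], [gamma_(k, n)] is
  a sign (or 0) depending on [n - l], times something larger than
  [psi q ^ l * r ^ M], up to a vanishing error. *)

Require Import Defs.
From mathcomp Require Import all_boot all_order all_algebra finmap.
From mathcomp Require Import all_classical all_reals all_analysis.
From mathcomp Require Import zify ring lra.

Set Implicit Arguments.
Unset Strict Implicit.
Unset Printing Implicit Defensive.

Import Order.TTheory GRing.Theory Num.Theory.
Import numFieldNormedType.Exports.

Local Open Scope classical_set_scope.
Local Open Scope ring_scope.

(** * Unordered sums *)

(** The sum is taken in the extended reals, where it always exists; equality with a real number is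
    what encodes summability. *)
Definition nnsum {R : realType} {I : choiceType} (f : I -> R) (s : R) :=
  (forall i, 0 <= f i) /\ \esum_(i in [set: I]) (f i)%:E = s%:E.

(* Unconditional summability, encoded as a difference of two nonnegative families
   with finite sums. *)
Definition hassum {R : realType} {I : choiceType} (f : I -> R) (s : R) :=
  exists p n P N, [/\ nnsum p P, nnsum n N, forall i, f i = p i - n i
    & s = P - N].

Section NonnegativeSums.
Context {R : realType}.
Implicit Types I J : choiceType.

Lemma nnsum_fset_le I (f : I -> R) s (A : {fset I}) :
  nnsum f s -> \sum_(i <- A) f i <= s.
Proof.
move=> [f0 fs]; rewrite -lee_fin -fs -sumEFin; apply: esum_ge.
by exists [set` A]; rewrite ?fsbig_finite ?set_fsetK//; split.
Qed.

Lemma nnsum_lt_fset I (f : I -> R) s e : 0 < e -> nnsum f s ->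
  exists A : {fset I}, s - e < \sum_(i <- A) f i.
Proof.
move=> e0 [f0 fs].
have : ((s - e)%:E < \esum_(i in [set: I]) (f i)%:E)%E.
  by rewrite fs lte_fin; lra.
move=> /ereal_sup_gt[_ [X [finX _]] <-].
rewrite fsbig_finite//= sumEFin lte_fin => sX.
by exists (fset_set X).
Qed.

Lemma nnsum_ge0 I (f : I -> R) s : nnsum f s -> 0 <= s.
Proof. by move=> [f0 fs]; rewrite -lee_fin -fs esum_ge0// => i _; rewrite lee_fin. Qed.

Lemma nnsum_dom I (f g : I -> R) s : (forall i, 0 <= f i <= g i) -> nnsum g s ->
  exists2 t, nnsum f t & t <= s.
Proof.
move=> fg [g0 gs]; have f0 i : 0 <= f i by case/andP: (fg i).
have le : (\esum_(i in [set: I]) (f i)%:E <= s%:E)%E.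
  by rewrite -gs; apply: le_esum => i _; rewrite lee_fin; case/andP: (fg i).
have fin : (\esum_(i in [set: I]) (f i)%:E)%E \is a fin_num.
  rewrite fin_numE gt_eqF ?lt_eqF//; first exact: le_lt_trans le (ltry _).
  by rewrite (lt_le_trans (ltNyr 0))// esum_ge0// => i _; rewrite lee_fin.
exists (fine (\esum_(i in [set: I]) (f i)%:E)); last by rewrite -lee_fin fineK.
by split=> //; rewrite fineK.
Qed.

Lemma nnsumD I (f g : I -> R) s t : nnsum f s -> nnsum g t ->
  nnsum (fun i => f i + g i) (s + t).
Proof.
move=> [f0 fs] [g0 gt]; split=> [i|]; first exact: addr_ge0.
under eq_esum do rewrite EFinD.
by rewrite esumD ?fs ?gt// => i _; rewrite lee_fin.
Qed.

Lemma nnsum_unique I (f : I -> R) s t : nnsum f s -> nnsum f t -> s = t.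
Proof. by move=> [_ fs] [_]; rewrite fs => -[]. Qed.

Lemma nnsum_eq I (f g : I -> R) s : f =1 g -> nnsum f s -> nnsum g s.
Proof. by move=> /funext ->. Qed.

Lemma nnsum0 I : nnsum (fun _ : I => 0 : R) 0.
Proof. by split=> //; rewrite esum1. Qed.

(** The upper bound is checked on finite partial sums; the lower one is the same bound for the
    factor [c^-1] and the scaled family. *)
Lemma nnsumZ I (f : I -> R) s c : 0 <= c -> nnsum f s ->
  nnsum (fun i => c * f i) (c * s).
Proof.
move=> c0 fs; case: (ltgtP c 0) c0 => // [c0 _|-> _]; last first.
  by rewrite mul0r; apply: nnsum_eq (nnsum0 I) => i; rewrite mul0r.
have [f0 _] := fs.
have le a (g : I -> R) t : 0 < a -> (forall i, 0 <= g i) -> nnsum g t ->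
    (\esum_(i in [set: I]) (a * g i)%:E <= (a * t)%:E)%E.
  move=> a0 g0 gt; apply: ge_ereal_sup => _ [X [finX _] <-].
  rewrite fsbig_finite//= sumEFin lee_fin -mulr_sumr ler_pM2l//.
  exact: nnsum_fset_le.
split=> [i|]; first by rewrite mulr_ge0// ltW.
have fin : (\esum_(i in [set: I]) (c * f i)%:E)%E \is a fin_num.
  rewrite fin_numE gt_eqF ?lt_eqF//.
    exact: le_lt_trans (le _ _ _ c0 f0 fs) (ltry _).
  rewrite (lt_le_trans (ltNyr 0))// esum_ge0// => i _.
  by rewrite lee_fin mulr_ge0// ltW.
apply/eqP; rewrite eq_le le//=; rewrite -(fineK fin) lee_fin.
set t := fine _; rewrite -ler_pdivlMl// -lee_fin.
have <- : (\esum_(i in [set: I]) (c^-1 * (c * f i))%:E = s%:E)%E.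
  by rewrite -fs.2; apply: eq_esum => i _; rewrite mulKf// gt_eqF.
apply: le => [|i|]; rewrite ?invr_gt0//; first by rewrite mulr_ge0// ltW.
by split=> [i|]; [rewrite mulr_ge0// ltW|rewrite /t fineK].
Qed.

Lemma nnsum_inj I J (e : I -> J) (f : J -> R) s : injective e ->
  (forall j, ~ range e j -> f j = 0) -> nnsum f s <-> nnsum (f \o e) s.
Proof.
move=> e_inj f0.
have E : (\esum_(j in [set: J]) (f j)%:E = \esum_(i in [set: I]) (f (e i))%:E)%E.
  rewrite -(@esum_image _ _ _ setT e (fun j => (f j)%:E)); last first.
    by move=> x y _ _; exact: e_inj.
  rewrite [RHS]esum_mkcond; apply: eq_esum => j _.
  by case: ifPn => // /negP; rewrite inE => /f0 ->.
split=> -[fp fs]; first by split=> [i|] /=; rewrite -?E.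
split=> [j|]; last by rewrite E.
have [[i _ <-]|/f0 ->//] := pselect (range e j); exact: fp.
Qed.

Lemma nnsum_fubini I J (f : I * J -> R) s : nnsum f s ->
  exists2 g, (forall i, nnsum (fun j => f (i, j)) (g i)) & nnsum g s.
Proof.
move=> [f0 fs].
pose g i := (\esum_(j in [set: J]) (f (i, j))%:E)%E.
have g0 i : (0 <= g i)%E by apply: esum_ge0 => j _; rewrite lee_fin.
have gs : (\esum_(i in [set: I]) g i = s%:E)%E.
  rewrite /g (@esum_esum _ _ _ setT (fun=> setT) (fun i j => (f (i, j))%:E))
    => [|i j _ _]; last first.
    by rewrite lee_fin.
  rewrite -fs; congr (esum _ _); first by apply/seteqP; split.
  by apply/funext => -[].
(* Each row sum is finite because the total of the row sums is. *)
have fin i : g i \is a fin_num.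
  rewrite fin_numE gt_eqF ?lt_eqF ?(lt_le_trans (ltNyr 0))//.
  rewrite -(gee0_abs (g0 i)); apply: (@summable_pinfty _ _ setT) => //.
  rewrite /summable (eq_esum (b := g)) ?gs ?ltry// => k _.
  by rewrite gee0_abs.
exists (fine \o g) => [i|]; first by split=> // ; rewrite /= fineK.
split=> [i|]; first exact: fine_ge0.
by rewrite -gs; apply: eq_esum => i _; rewrite fineK.
Qed.

Lemma nnsum_pair I J (f : I * J -> R) g s : (forall x, 0 <= f x) ->
  (forall i, nnsum (fun j => f (i, j)) (g i)) -> nnsum g s -> nnsum f s.
Proof.
move=> f0 fg [g0 gs]; split=> //; rewrite -gs.
transitivity (\esum_(i in [set: I]) \esum_(j in [set: J]) (f (i, j))%:E)%E.
  rewrite (@esum_esum _ _ _ setT (fun=> setT) (fun i j => (f (i, j))%:E))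
    => [|i j _ _]; last first.
    by rewrite lee_fin.
  congr (esum _ _); first by apply/seteqP; split.
  by apply/funext => -[].
by apply: eq_esum => i _; case: (fg i).
Qed.

End NonnegativeSums.

(** * Signed unconditional sums *)

Section Sums.
Context {R : realType}.
Implicit Types I J : choiceType.

Lemma max_posneg (x : R) : Num.max x 0 - Num.max (- x) 0 = x.
Proof. by case: (leP x 0); case: (leP (- x) 0); lra. Qed.

Lemma nnsum_hassum I (f : I -> R) s : nnsum f s -> hassum f s.
Proof.
by move=> fs; exists f, (fun=> 0), s, 0; split=> //;
  [exact: nnsum0|move=> i; rewrite subr0|rewrite subr0].
Qed.

(** Moving the negative parts across, [P + N'] and [P' + N] are sums of one and the same nonnegative
    family. *)
Lemma hassum_unique I (f : I -> R) s t : hassum f s -> hassum f t -> s = t.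
Proof.
move=> [p [n [P [N [pP nN fE ->]]]]] [p' [n' [P' [N' [pP' nN' fE' ->]]]]].
have : P + N' = P' + N; last lra.
apply: nnsum_unique (nnsumD pP nN') _.
by apply: nnsum_eq (nnsumD pP' nN) => i; have := fE i; rewrite fE'; lra.
Qed.

Lemma hassum_eq I (f g : I -> R) s : f =1 g -> hassum f s -> hassum g s.
Proof. by move=> /funext ->. Qed.

Lemma hassumD I (f g : I -> R) s t : hassum f s -> hassum g t ->
  hassum (fun i => f i + g i) (s + t).
Proof.
move=> [p [n [P [N [pP nN fE ->]]]]] [p' [n' [P' [N' [pP' nN' gE ->]]]]].
exists (fun i => p i + p' i), (fun i => n i + n' i), (P + P'), (N + N').
split; [exact: nnsumD|exact: nnsumD| |by ring].
by move=> i; rewrite fE gE; ring.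
Qed.

Lemma hassumZ I (f : I -> R) s c : hassum f s ->
  hassum (fun i => c * f i) (c * s).
Proof.
move=> [p [n [P [N [pP nN fE ->]]]]].
have [c0|c0] := leP 0 c.
  exists (fun i => c * p i), (fun i => c * n i), (c * P), (c * N).
  by split; [exact: nnsumZ|exact: nnsumZ|move=> i; rewrite fE mulrBr|rewrite mulrBr].
exists (fun i => - c * n i), (fun i => - c * p i), (- c * N), (- c * P).
split; [apply: nnsumZ => //; lra|apply: nnsumZ => //; lra| |by ring].
by move=> i; rewrite fE; ring.
Qed.

Lemma hassumB I (f g : I -> R) s t : hassum f s -> hassum g t ->
  hassum (fun i => f i - g i) (s - t).
Proof.
move=> fs /(@hassumZ _ _ _ (-1)) gt; rewrite -mulN1r.
by apply: hassum_eq (hassumD fs gt) => i; rewrite mulN1r.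
Qed.

Lemma hassum_nnsum I (f : I -> R) s : (forall i, 0 <= f i) -> hassum f s ->
  nnsum f s.
Proof.
move=> f0 fs; have [p [n [P [N [pP [n0 nN] fE _]]]]] := fs.
have [|t ft _] := @nnsum_dom _ _ f p P _ pP.
  by move=> i; rewrite f0/= fE; have := n0 i; lra.
by rewrite (hassum_unique fs (nnsum_hassum ft)).
Qed.

Lemma hassum_ge0 I (f : I -> R) s : (forall i, 0 <= f i) -> hassum f s -> 0 <= s.
Proof. by move=> f0 /hassum_nnsum-/(_ f0)/nnsum_ge0. Qed.

Lemma hassum_le I (f g : I -> R) s t : (forall i, f i <= g i) ->
  hassum f s -> hassum g t -> s <= t.
Proof.
move=> fg fs gt; rewrite -subr_ge0; apply: hassum_ge0 (hassumB gt fs) => i.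
by rewrite subr_ge0.
Qed.

(** The families [(g + f) / 2] and [(g - f) / 2] lie between 0 and [g], hence are summable, and
    their difference is [f]. *)
Lemma hassum_dom I (f g : I -> R) s : (forall i, `|f i| <= g i) -> hassum g s ->
  exists2 t, hassum f t & `|t| <= s.
Proof.
move=> fg gs; have g0 i : 0 <= g i by apply: le_trans (fg i).
have gs' := hassum_nnsum g0 gs.
have [|P pP _] := @nnsum_dom _ _ (fun i => (g i + f i) / 2) g s _ gs'.
  by move=> i; have := fg i; rewrite ler_norml; lra.
have [|N nN _] := @nnsum_dom _ _ (fun i => (g i - f i) / 2) g s _ gs'.
  by move=> i; have := fg i; rewrite ler_norml; lra.
have ft : hassum f (P - N).
  apply: hassum_eq (hassumB (nnsum_hassum pP) (nnsum_hassum nN)) => i; lra.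
exists (P - N) => //; rewrite ler_norml; apply/andP; split.
  rewrite -mulN1r; apply: hassum_le (hassumZ (-1) gs) ft => i.
  by have := fg i; rewrite ler_norml; lra.
by apply: hassum_le ft gs => i; have := fg i; rewrite ler_norml; lra.
Qed.

(** Any decomposition [p - n] dominates the canonical one. Unlike [p] and [n], the canonical parts
    vanish wherever [f] does, which reindexing needs. *)
Lemma hassum_posneg I (f : I -> R) s : hassum f s -> exists P N,
  [/\ nnsum (fun i => Num.max (f i) 0) P, nnsum (fun i => Num.max (- f i) 0) N
    & s = P - N].
Proof.
move=> fs; have [p [n [P [N [[p0 pP] [n0 nN] fE _]]]]] := fs.
have [|P' fP _] := @nnsum_dom _ _ (fun i => Num.max (f i) 0) p P _ (conj p0 pP).
  by move=> i; rewrite le_max lexx orbT/= ge_max p0 fE; have := n0 i; lra.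
have [|N' fN _] := @nnsum_dom _ _ (fun i => Num.max (- f i) 0) n N _ (conj n0 nN).
  by move=> i; rewrite le_max lexx orbT/= ge_max n0 fE; have := p0 i; lra.
exists P', N'; split=> //; apply: (hassum_unique fs).
apply: hassum_eq (hassumB (nnsum_hassum fP) (nnsum_hassum fN)) => i.
exact: max_posneg.
Qed.

Lemma hassum_norm I (f : I -> R) s : hassum f s ->
  exists t, hassum (fun i => `|f i|) t.
Proof.
move=> /hassum_posneg[P [N [fP fN _]]]; exists (P + N).
apply: hassum_eq (hassumD (nnsum_hassum fP) (nnsum_hassum fN)) => i.
by case: (leP (f i) 0); case: (leP (- f i) 0); case: (ger0P (f i)); lra.
Qed.

Lemma hassum_inj I J (e : I -> J) (f : J -> R) s : injective e ->
  (forall j, ~ range e j -> f j = 0) -> hassum f s <-> hassum (f \o e) s.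
Proof.
move=> e_inj f0.
have fp : forall j, ~ range e j -> Num.max (f j) 0 = 0.
  by move=> j /f0 ->; rewrite maxxx.
have fn : forall j, ~ range e j -> Num.max (- f j) 0 = 0.
  by move=> j /f0 ->; rewrite oppr0 maxxx.
split=> /hassum_posneg[P [N [fP fN ->]]].
- apply: (hassum_eq (fun i => max_posneg (f (e i)))).
  by apply: hassumB; apply: nnsum_hassum; [move/(nnsum_inj _ e_inj fp): fP|
    move/(nnsum_inj _ e_inj fn): fN].
- apply: (hassum_eq (fun j => max_posneg (f j))).
  by apply: hassumB; apply: nnsum_hassum; [apply/(nnsum_inj _ e_inj fp)|
    apply/(nnsum_inj _ e_inj fn)].
Qed.

Lemma hassum_bij I J (e : I -> J) (f : J -> R) s : bijective e ->
  hassum f s <-> hassum (f \o e) s.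
Proof.
move=> [e' eK e'K]; apply: hassum_inj; first exact: can_inj eK.
by move=> j []; exists (e' j).
Qed.

Lemma hassum_single I i0 (f : I -> R) : (forall i, i != i0 -> f i = 0) ->
  hassum f (f i0).
Proof.
move=> f0; apply/(@hassum_inj unit I (fun=> i0)) => [[][]//|j ji|].
  by apply: f0; apply: contra_notN ji => /eqP ->; exists tt.
have one : nnsum (fun _ : unit => 1 : R) 1.
  split=> [_|]; first exact: ler01.
  rewrite (_ : setT = [set tt]) ?esum_set1 ?lee_fin//.
  by apply/seteqP; split=> [[]|].
rewrite -[X in hassum _ X]mulr1.
by apply: hassum_eq (hassumZ (f i0) (nnsum_hassum one)) => i /=; rewrite mulr1.
Qed.

Lemma hassum_term_le I i (f : I -> R) s : (forall j, 0 <= f j) -> hassum f s ->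
  f i <= s.
Proof.
move=> f0; have := @hassum_single I i (fun j => if j == i then f j else 0).
rewrite eqxx => /(_ (fun j => ifN_eq _ _)) fi fs; apply: hassum_le _ fi fs => j.
by case: ifP.
Qed.

Lemma hassum_fubini I J (f : I * J -> R) s : hassum f s ->
  exists2 g, (forall i, hassum (fun j => f (i, j)) (g i)) & hassum g s.
Proof.
move=> [p [n [P [N [pP nN fE ->]]]]].
have [P' pP' PP'] := nnsum_fubini pP; have [N' nN' NN'] := nnsum_fubini nN.
exists (fun i => P' i - N' i) => [i|]; last first.
  by apply: hassumB; exact: nnsum_hassum.
apply: hassum_eq (hassumB (nnsum_hassum (pP' i)) (nnsum_hassum (nN' i))) => j.
by rewrite fE.
Qed.

Lemma hassum_pair I J (f h : I * J -> R) g s : (forall x, `|f x| <= h x) ->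
  (forall i, hassum (fun j => h (i, j)) (g i)) -> hassum g s ->
  exists t, hassum f t.
Proof.
move=> fh hg gs; have h0 x : 0 <= h x by apply: le_trans (fh x).
have [|t ft _] := @hassum_dom _ f h s fh; last by exists t.
apply/nnsum_hassum/nnsum_pair => // [i|].
  by apply: hassum_nnsum (hg i) => j.
by apply: hassum_nnsum gs => i; apply: hassum_ge0 (hg i).
Qed.

(** Absolute values show that the double family is summable; its value is then computed row by row
    with Fubini. *)
Lemma hassum_prod I J (f : I -> R) (g : J -> R) s t : hassum f s -> hassum g t ->
  hassum (fun x => f x.1 * g x.2) (s * t).
Proof.
move=> fs gt; have [s' fs'] := hassum_norm fs; have [t' gt'] := hassum_norm gt.
have [z fgz] : exists z, hassum (fun x => f x.1 * g x.2) z.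
  apply: (@hassum_pair _ _ _ (fun x => `|f x.1| * `|g x.2|)
    (fun i => t' * `|f i|) (t' * s')) => [x|i|].
  - by rewrite normrM.
  - by have := hassumZ `|f i| gt'; rewrite mulrC.
  - exact: hassumZ.
have [h hE hz] := hassum_fubini fgz.
suff -> : s * t = z by [].
have : hassum (fun i => t * f i) (s * t) by rewrite mulrC; exact: hassumZ.
move=> /hassum_unique; apply; apply: hassum_eq hz => i.
by rewrite [RHS]mulrC; exact: hassum_unique (hE i) (hassumZ (f i) gt).
Qed.

Lemma hassum_cvg I (f : I -> R) s : hassum f s ->
  summability.partial_sum f @ summability.totally --> s.
Proof.
move=> [p [n [P [N [pP nN fE ->]]]]].
have FF := @summability.totally_filter I; apply/cvgrPdist_lt => e e0.
have [A PA] := nnsum_lt_fset e0 pP; have [A' NA] := nnsum_lt_fset e0 nN.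
(* On every finite [B] containing both sets, the sums of [p] and [n] lie below [P] and [N] by less
   than [e], so their difference is within [e] of [P - N]. *)
exists (A `|` A')%fset => //= B; rewrite /= fsubUset => /andP[AB A'B].
have mono g (C : {fset I}) : (forall i, 0 <= g i) -> (C `<=` B)%fset ->
    \sum_(i <- C) g i <= \sum_(i <- B) g i :> R.
  move=> g0 CB; rewrite [leRHS](big_fsetID _ (mem C))/=.
  have -> : [fset x in B | x \in C]%fset = C.
    apply/fsetP => x; rewrite !inE andbC.
    by case: (boolP (x \in C)) => // /(fsubsetP CB) ->.
  by rewrite lerDl sumr_ge0.
have := mono p A pP.1 AB; have := mono n A' nN.1 A'B.
have := nnsum_fset_le B pP; have := nnsum_fset_le B nN.
have -> : summability.partial_sum f B = \sum_(i <- B) f i.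
  by rewrite /summability.partial_sum big_seq_fsetE.
rewrite (eq_bigr _ (fun i _ => fE i)) sumrB.
by rewrite ltr_norml; lra.
Qed.

Lemma hassum_sum I (f : I -> R) s : hassum f s -> summability.sum f = s.
Proof.
have FF := @summability.totally_filter I.
by move=> /hassum_cvg; exact: cvg_lim.
Qed.

End Sums.

(** * Sums over the integers *)

Lemma normrXz (K : numFieldType) (x : K) (m : int) : `|x ^ m| = `|x| ^ m.
Proof. by case: m => n; rewrite /exprz ?normfV normrX. Qed.

Lemma exprzN1_double (K : fieldType) (m : int) : (-1) ^ (2 * m) = 1 :> K.
Proof. by rewrite -exprz_exp -[(-1) ^ 2]exprnP sqrrN expr1n exp1rz. Qed.

Lemma exprzN1_even (K : fieldType) (a b c : int) : a = b + 2 * c ->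
  (-1) ^ a = (-1) ^ b :> K.
Proof. by move=> ->; rewrite expfzDr ?oppr_eq0 ?oner_eq0// exprzN1_double mulr1. Qed.

Lemma exprzN1_mulss (K : fieldType) (m : int) : (-1) ^ m * (-1) ^ m = 1 :> K.
Proof.
rewrite -expfzDr ?oppr_eq0 ?oner_eq0// (_ : m + m = 2 * m) ?exprzN1_double//; ring.
Qed.

Lemma int_parity (m : int) : (exists u, m = 2 * u) \/ (exists u, m = 2 * u + 1).
Proof.
have := divz_eq m 2; have := ltz_pmod m (isT : 0 < 2 :> int).
have := modz_ge0 m (isT : 2 != 0 :> int) => m0 m2 ->.
have [->|->] : (m %% 2)%Z = 0 \/ (m %% 2)%Z = 1 by lia.
- by left; exists (m %/ 2)%Z; ring.
- by right; exists (m %/ 2)%Z; ring.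
Qed.

Definition tri (m : int) : int := ((m * (m - 1)) %/ 2)%Z.

Lemma triE m : tri m * 2 = m * (m - 1).
Proof.
rewrite /tri divzK//; have [[u ->]|[u ->]] := int_parity m.
- by rewrite -mulrA dvdz_mulr.
- by rewrite addrK mulrCA dvdz_mulr.
Qed.

Lemma tri_ge0 m : 0 <= tri m.
Proof. by rewrite -(pmulr_lge0 (x := 2)) ?triE//; have [|] := leP m 0; nia. Qed.

Lemma triD u v : tri (u + v) + tri (u - v) = u * (u - 1) + v * v.
Proof. by apply: (mulIf (isT : 2 != 0 :> int)); rewrite mulrDl !triE; ring. Qed.

Lemma triD1 u v : tri (u + v) + tri (u + 1 - v) = v * (v - 1) + u * u.
Proof. by apply: (mulIf (isT : 2 != 0 :> int)); rewrite mulrDl !triE; ring. Qed.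

Section IntegerSums.
Context {R : realType}.
Variable r : R.
Hypothesis r01 : 0 < r < 1.

Let r_gt0 : 0 < r. Proof. by case/andP: r01. Qed.
Let r_ge0 : 0 <= r. Proof. exact: ltW. Qed.
Let r_lt1 : r < 1. Proof. by case/andP: r01. Qed.
Let r_le1 : r <= 1. Proof. exact: ltW. Qed.


Lemma nnsum_geometric : nnsum (fun i : nat => r ^+ i) (1 - r)^-1.
Proof.
have r0 (i : nat) : 0 <= r ^+ i by exact: exprn_ge0.
split=> //; rewrite -nneseries_esumT => [|i]; last by rewrite lee_fin.
rewrite -[X in X%:E]mul1r.
have cv : series (geometric 1 r) @ \oo --> (1 * (1 - r)^-1).
  by apply: cvg_geometric_series; rewrite ger0_norm.
rewrite -(cvg_lim (@Rhausdorff R) cv) -EFin_lim; last exact: cvgP cv.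
apply: congr_lim; apply/funext => n /=.
by rewrite sumEFin; congr EFin; apply: eq_bigr => i _ /=; rewrite mul1r.
Qed.

(** The shift on the positive side suits [tri]: both [tri i.+1] and [tri (- i)] equal
    [i (i + 1) / 2], which is at least [i]. *)
Lemma hassum_int (f : int -> R) :
  (forall i : nat, `|f i.+1| <= r ^+ i) -> (forall i : nat, `|f (- i%:Z)| <= r ^+ i) ->
  exists2 s, hassum f s & `|s| <= 2 / (1 - r).
Proof.
move=> fp fn; have geo := nnsum_hassum nnsum_geometric.
have [s fs ls] := hassum_dom fp geo; have [t ft lt] := hassum_dom fn geo.
exists (s + t); last by rewrite (le_trans (ler_normD _ _))// mulr_natl mulr2n lerD.
apply: (@hassum_eq _ _
  (fun m => (if 0 < m then f m else 0) + (if 0 < m then 0 else f m))).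
  by move=> m; case: ifP; rewrite ?addr0 ?add0r.
apply: hassumD.
  apply/(@hassum_inj _ _ _ (fun i : nat => i.+1%:Z)) => [i j []//|m mi|//].
  case: ifP => // m0; exfalso; apply: mi; exists `|m|.-1%N => //; lia.
apply/(@hassum_inj _ _ _ (fun i : nat => - i%:Z)) => [i j|m mi|].
- by move/oppr_inj => [].
- case: ifP => // m0; exfalso; apply: mi; exists `|m|%N => //; lia.
- apply: hassum_eq ft => i /=; case: ifP => //; lia.
Qed.

Lemma hassum_tri (f : int -> R) (C : R) : (forall m, `|f m| <= C * r ^ tri m) ->
  exists2 s, hassum f s & `|s| <= C * (2 / (1 - r)).
Proof.
move=> fC.
have le (m a : int) : 0 <= a -> a <= tri m -> r ^ tri m <= r ^ a.
  by move=> a0 am; apply: ler_wpiXz2l => //; exact: tri_ge0.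
have [s ws ls] : exists2 s, hassum (fun m => r ^ tri m) s & `|s| <= 2 / (1 - r).
  apply: hassum_int => i; rewrite ger0_norm ?exprz_ge0 ?exprnP//.
    by apply: le => //; have := triE i.+1; nia.
  by apply: le => //; have := triE (- i%:Z); nia.
have [t ft lt] := hassum_dom fC (hassumZ C ws).
exists t => //; apply: le_trans lt _; apply: ler_wpM2l.
  (* At index 0, where [tri] is 0, the hypothesis gives [0 <= C]. *)
  by have := fC 0; rewrite /tri mul0r div0z mulr1; apply: le_trans.
exact: le_trans (ler_norm _) ls.
Qed.

End IntegerSums.

(** * Recursion on the number of variables *)

Definition fcons k (x : int * {ffun 'I_k -> int}) : {ffun 'I_k.+1 -> int} :=
  [ffun i => oapp x.2 x.1 (unlift ord0 i)].

Lemma fcons_bij k : bijective (@fcons k).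
Proof.
exists (fun v : {ffun 'I_k.+1 -> int} => (v ord0, [ffun j => v (lift ord0 j)])).
  move=> [a v]; congr (_, _); first by rewrite ffunE unlift_none.
  by apply/ffunP => j; rewrite !ffunE liftK.
move=> v; apply/ffunP => i; rewrite !ffunE.
by case: unliftP => [j ->|->] /=; rewrite ?ffunE.
Qed.

Lemma sum_fcons k (V : zmodType) (f : int -> V) x :
  \sum_i f (@fcons k x i) = f x.1 + \sum_i f (x.2 i).
Proof.
rewrite big_ord_recl ffunE unlift_none /=; congr (_ + _).
by apply: eq_bigr => i _; rewrite ffunE liftK.
Qed.

Section GammaRecursion.
Context {R : realType}.
Variable q : R.
Hypothesis q_neq0 : q != 0.
Hypothesis q_lt1 : `|q| < 1.

Let r01 : 0 < `|q| < 1. Proof. by rewrite normr_gt0 q_neq0. Qed.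
Local Notation T := (2 / (1 - `|q|)).

Let T_ge0 : 0 <= T.
Proof. by rewrite divr_ge0// subr_ge0 ltW. Qed.

(** Without the constraint on the sum of the coordinates, the series is a product of [k]
    one-variable series. It dominates the terms of [gamma k n q] for all [n] at once. *)
Lemma hassum_norm_weight k : exists2 s,
  hassum (fun m : {ffun 'I_k -> int} => `|q| ^ (\sum_i tri (m i))) s & `|s| <= T ^+ k.
Proof.
elim: k => [|k [s ms ls]].
  exists 1; last by rewrite normr1.
  have := @hassum_single R {ffun 'I_0 -> int} [ffun=> 0]
    (fun m : {ffun 'I_0 -> int} => `|q| ^ (\sum_i tri (m i))).
  rewrite big_ord0; apply => m /eqP[]; apply/ffunP; by case.
have [|t ft lt] := @hassum_tri R `|q| r01 (fun m => `|q| ^ tri m) 1.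
  by move=> m; rewrite mul1r ger0_norm// exprz_ge0.
exists (t * s); last by rewrite normrM exprS ler_pM// -[T]mul1r.
apply/(hassum_bij _ _ (fcons_bij k)); apply: hassum_eq (hassum_prod ft ms) => x /=.
by rewrite sum_fcons expfzDr// normr_eq0.
Qed.

(** Extension by zero from the index subtype of [gamma] to all functions, so that Fubini and
    reindexing by [fcons] apply. *)
Definition gamma_term k n (m : {ffun 'I_k -> int}) : R :=
  if \sum_i m i == n then q ^ (\sum_i tri (m i)) else 0.

Lemma hassum_gamma_term k n :
  hassum (gamma_term n : {ffun 'I_k -> int} -> R) (gamma k n q) /\
  `|gamma k n q| <= T ^+ k.
Proof.
have [s ms ls] := hassum_norm_weight k.
have [|g mg lg] := @hassum_dom R _ (gamma_term n : {ffun 'I_k -> int} -> R) _ _ _ ms.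
  by move=> m; rewrite /gamma_term; case: ifP; rewrite ?normr0 ?exprz_ge0// normrXz.
suff -> : gamma k n q = g by split=> //; apply: le_trans lg (le_trans (ler_norm _) ls).
apply: hassum_sum.
pose A := {m : {ffun 'I_k -> int} | \sum_(i < k) m i == n}.
have mg' : hassum ((gamma_term n : {ffun 'I_k -> int} -> R) \o (val : A -> _)) g.
  apply/(@hassum_inj R A _ val (gamma_term n) g val_inj) => // m mA.
  rewrite /gamma_term; case: ifP => // mn.
  by exfalso; apply: mA; exists (exist _ m mn).
apply: hassum_eq mg' => -[m mn] /=; rewrite /gamma_term mn; congr (q ^ _).
(* Halving the total agrees with summing the halves, since every [m i * (m i - 1)] is twice
   [tri (m i)]. *)
under eq_bigr do rewrite -triE.
by rewrite -mulr_suml mulzK.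
Qed.

Lemma gamma_norm_le k n : `|gamma k n q| <= T ^+ k.
Proof. by case: (hassum_gamma_term k n). Qed.

(** Fubini along the first coordinate [a]; the other coordinates must then add up to [n - a]. *)
Lemma gammaS k n :
  hassum (fun a => q ^ tri a * gamma k (n - a) q) (gamma k.+1 n q).
Proof.
have [/(hassum_bij _ _ (fcons_bij k))/hassum_fubini[g gE] + _] := hassum_gamma_term k.+1 n.
apply: hassum_eq => a; apply: hassum_unique (gE a) _.
have [/(hassumZ (q ^ tri a)) + _] := hassum_gamma_term k (n - a).
apply: hassum_eq => v; rewrite /gamma_term /= (sum_fcons id) sum_fcons /=.
rewrite [a + _]addrC -[_ == n - a]subr_eq opprK; case: ifP; rewrite ?mulr0//.
by rewrite expfzDr.
Qed.

Lemma gamma0 n : gamma 0 n q = if n == 0 then 1 else 0.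
Proof.
have [+ _] := hassum_gamma_term 0 n.
move=> /hassum_unique; apply.
have := @hassum_single R {ffun 'I_0 -> int} [ffun=> 0] (gamma_term n).
rewrite (_ : gamma_term n _ = if n == 0 then 1 else 0); last first.
  by rewrite /gamma_term !big_ord0 eq_sym expr0z.
by apply => m /eqP[]; apply/ffunP; case.
Qed.

Lemma gamma1 n : gamma 1 n q = q ^ tri n.
Proof.
have /hassum_unique := gammaS 0 n; apply.
have := @hassum_single R int n (fun a => q ^ tri a * gamma 0 (n - a) q).
rewrite subrr gamma0 eqxx mulr1; apply => a an.
by rewrite gamma0 subr_eq0 eq_sym (negPf an) mulr0.
Qed.

End GammaRecursion.

(** * Theta series *)

Section Parity.
Context {R : realType}.

Lemma hassum_split (I : choiceType) (P : pred I) (f : I -> R) s : hassum f s -> exists s0 s1,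
  [/\ hassum (fun i => if P i then f i else 0) s0,
      hassum (fun i => if P i then 0 else f i) s1 & s = s0 + s1].
Proof.
move=> fs; have [t ft] := hassum_norm fs.
have [|s0 fs0 _] := @hassum_dom R I (fun i => if P i then f i else 0) _ _ _ ft.
  by move=> i; case: ifP; rewrite // normr0.
have [|s1 fs1 _] := @hassum_dom R I (fun i => if P i then 0 else f i) _ _ _ ft.
  by move=> i; case: ifP; rewrite // normr0.
exists s0, s1; split=> //; apply: (hassum_unique fs).
by apply: hassum_eq (hassumD fs0 fs1) => i; case: ifP; rewrite ?addr0 ?add0r.
Qed.

(* Reindexes the pairs [(a, b)] by [u = (a + b) %/ 2] and [v = a - u]. *)
Lemma hassum_parity (f : int * int -> R) s : hassum f s -> exists s0 s1,
  [/\ hassum (fun x => f (x.1 + x.2, x.1 - x.2)) s0,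
      hassum (fun x => f (x.1 + x.2, x.1 + 1 - x.2)) s1 & s = s0 + s1].
Proof.
move=> /(hassum_split (fun x => 2 %| x.1 + x.2)%Z)[s0 [s1 [fs0 fs1 ->]]].
exists s0, s1; split=> //.
- pose e (x : int * int) := (x.1 + x.2, x.1 - x.2).
  have e_inj : injective e by move=> [a b] [c d] [ac bd]; congr (_, _); lia.
  have out j : ~ range e j -> (if (2 %| j.1 + j.2)%Z then f j else 0) = 0.
    move: j => [a b] ab; case: ifP => // /dvdzP[c /= cE]; exfalso; apply: ab.
    by exists (c, a - c) => //; congr (_, _) => /=; lia.
  have := (hassum_inj s0 e_inj out).1 fs0; apply: hassum_eq => -[a b] /=.
  by rewrite (_ : a + b + _ = a * 2) ?dvdz_mull//; ring.
- pose e (x : int * int) := (x.1 + x.2, x.1 + 1 - x.2).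
  have e_inj : injective e by move=> [a b] [c d] [ac bd]; congr (_, _); lia.
  have out j : ~ range e j -> (if (2 %| j.1 + j.2)%Z then 0 else f j) = 0.
    move: j => [a b] ab; case: ifP => // /negP nd; exfalso.
    have [[c cE]|[c cE]] := int_parity (a + b).
      by apply: nd; rewrite cE dvdz_mulr.
    by apply: ab; exists (c, a - c) => //; congr (_, _) => /=; lia.
  have := (hassum_inj s1 e_inj out).1 fs1; apply: hassum_eq => -[a b] /=.
  by case: ifP => // /dvdzP[c]; lia.
Qed.

End Parity.

Section Theta.
Context {R : realType}.
Implicit Types q r : R.

Definition theta q : R := summability.sum (fun v : int => q ^ (v * v)).
Definition psi q : R := summability.sum (fun v : int => q ^ (v * (v - 1))).

Lemma exprz_tri_le q (m a : int) : q != 0 -> `|q| < 1 -> tri m <= a ->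
  `|q ^ a| <= `|q| ^ tri m.
Proof.
move=> q0 q1 ma; rewrite normrXz; apply: ler_wpiXz2l => //.
- exact: ltW.
- exact: le_trans (tri_ge0 m) ma.
- exact: tri_ge0.
Qed.

Lemma tri_le_sqr m : tri m <= m * m. Proof. have := triE m; nia. Qed.

Lemma tri_le_double m : tri m <= m * (m - 1).
Proof. have := triE m; have := tri_ge0 m; lia. Qed.

(** Serves both weights of the two-step recursion, [u * u] and [u * (u - 1)], with a bound uniform
    in the bounded factor [f]. *)
Lemma hassum_weighted q (f : int -> R) (a : int -> int) C : q != 0 -> `|q| < 1 ->
  (forall m, `|f m| <= C) -> (forall m, tri m <= a m) ->
  exists2 s, hassum (fun m => q ^ a m * f m) s & `|s| <= C * (2 / (1 - `|q|)).
Proof.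
move=> q0 q1 fC ta; apply: hassum_tri => [|m]; first by rewrite normr_gt0 q0.
by rewrite normrM mulrC ler_pM// exprz_tri_le.
Qed.

Lemma hassum_theta q : q != 0 -> `|q| < 1 ->
  hassum (fun v : int => q ^ (v * v)) (theta q) /\ `|theta q| <= 2 / (1 - `|q|).
Proof.
move=> q0 q1.
have [|s fs ls] := @hassum_weighted q (fun=> 1) (fun v => v * v) 1 q0 q1 _ tri_le_sqr.
  by move=> m; rewrite normr1.
have fs' : hassum (fun v : int => q ^ (v * v)) s.
  by apply: hassum_eq fs => v; rewrite mulr1.
by rewrite /theta (hassum_sum fs'); split=> //; rewrite mul1r in ls.
Qed.

Lemma hassum_psi q : q != 0 -> `|q| < 1 ->
  hassum (fun v : int => q ^ (v * (v - 1))) (psi q) /\ `|psi q| <= 2 / (1 - `|q|).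
Proof.
move=> q0 q1.
have [|s fs ls] := @hassum_weighted q (fun=> 1) (fun v => v * (v - 1)) 1 q0 q1 _
    tri_le_double.
  by move=> m; rewrite normr1.
have fs' : hassum (fun v : int => q ^ (v * (v - 1))) s.
  by apply: hassum_eq fs => v; rewrite mulr1.
by rewrite /psi (hassum_sum fs'); split=> //; rewrite mul1r in ls.
Qed.

(** Two coordinates are peeled off and split by the parity of their sum. In each branch the exponent
    separates into a part in [u] and a part in [v], and the remaining [gamma] depends on [u] alone,
    so the double sum is a product. *)
Lemma gammaSS q k n : q != 0 -> `|q| < 1 -> exists A B,
  [/\ hassum (fun u => q ^ (u * (u - 1)) * gamma k (n - 2 * u) q) A,
      hassum (fun u => q ^ (u * u) * gamma k (n - 1 - 2 * u) q) B
    & gamma k.+2 n q = theta q * A + psi q * B].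
Proof.
move=> q0 q1; set T := 2 / (1 - `|q|).
pose f (x : int * int) := q ^ tri x.1 * (q ^ tri x.2 * gamma k (n - x.1 - x.2) q).
have [w ws _] : exists2 s, hassum (fun m => `|q| ^ tri m) s & `|s| <= 1 * T.
  apply: hassum_tri => [|m]; first by rewrite normr_gt0 q0.
  by rewrite mul1r ger0_norm// exprz_ge0.
have [s fs] : exists s, hassum f s.
  have hs := hassumZ (T ^+ k) (hassum_prod ws ws).
  have [|s fs _] := @hassum_dom R _ f _ _ _ hs; last by exists s.
  move=> x; rewrite /f !normrM !normrXz mulrA mulrC ler_wpM2r ?mulr_ge0 ?exprz_ge0//.
  exact: gamma_norm_le.
have [g gE gs] := hassum_fubini fs.
have -> : gamma k.+2 n q = s.
  apply: hassum_unique (gammaS q0 q1 k.+1 n) _; apply: hassum_eq gs => a.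
  exact: hassum_unique (gE a) (hassumZ (q ^ tri a) (gammaS q0 q1 k (n - a))).
have [A fA _] := hassum_weighted q0 q1
  (fun u => gamma_norm_le q0 q1 k (n - 2 * u)) tri_le_double.
have [B fB _] := hassum_weighted q0 q1
  (fun u => gamma_norm_le q0 q1 k (n - 1 - 2 * u)) tri_le_sqr.
have [s0 [s1 [fs0 fs1 ->]]] := hassum_parity fs.
exists A, B; split=> //; congr (_ + _).
- rewrite mulrC; apply: hassum_unique fs0 _.
  apply: hassum_eq (hassum_prod fA (hassum_theta q0 q1).1) => -[u v]; rewrite /f /=.
  rewrite [RHS]mulrA -expfzDr// triD expfzDr//.
  by rewrite (_ : n - (u + v) - (u - v) = n - 2 * u); [ring|lia].
- rewrite mulrC; apply: hassum_unique fs1 _.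
  apply: hassum_eq (hassum_prod fB (hassum_psi q0 q1).1) => -[u v]; rewrite /f /=.
  rewrite [RHS]mulrA -expfzDr// triD1 expfzDr//.
  by rewrite (_ : n - (u + v) - (u + 1 - v) = n - 1 - 2 * u); [ring|lia].
Qed.

(** [v * v] and [v] differ by [2 * tri v]. *)
Lemma exprzN_sqr q (v : int) : (- q) ^ (v * v) = (-1) ^ v * q ^ (v * v).
Proof.
rewrite -[- q]mulN1r expfzMl (@exprzN1_even _ (v * v) v (tri v))//.
by have := triE v; lia.
Qed.

(** In the even branch the exponents [(u + v)^2] and [(u - v)^2] add up to [2 u^2 + 2 v^2] and the
    sign is [(-1)^(u + v)], so the sum factors as a square. The odd branch cancels. *)
Lemma theta_mulN q : q != 0 -> `|q| < 1 ->
  theta q * theta (- q) = theta (- (q * q)) ^+ 2.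
Proof.
move=> q0 q1; have Nq0 : - q != 0 by rewrite oppr_eq0.
have Nq1 : `|- q| < 1 by rewrite normrN.
have [tq _] := hassum_theta q0 q1; have [tNq _] := hassum_theta Nq0 Nq1.
have qq0 : - (q * q) != 0 by rewrite oppr_eq0 mulf_neq0.
have qq1 : `|- (q * q)| < 1 by rewrite normrN normrM mulr_ilt1.
have [tqq _] := hassum_theta qq0 qq1.
have [s0 [s1 [fs0 fs1 ->]]] := hassum_parity (hassum_prod tq tNq).
(* [v |-> 1 - v] swaps the pair [(a, b)], and [a + b] is odd. *)
have -> : s1 = 0.
  suff : s1 = - s1 by lra.
  have bij : bijective (fun x : int * int => (x.1, 1 - x.2)).
    by exists (fun x : int * int => (x.1, 1 - x.2)) => -[a b]; rewrite /= subKr.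
  move/(hassum_bij _ _ bij): (fs1) => /hassum_unique; apply.
  rewrite -[- s1]mulN1r; apply: hassum_eq (hassumZ (-1) fs1) => -[u v] /=.
  rewrite !exprzN_sqr.
  rewrite (_ : u + (1 - v) = u + 1 - v); last ring.
  rewrite (_ : u + 1 - (1 - v) = u + v); last ring.
  rewrite (@exprzN1_even _ (u + 1 - v) (u + v + 1) (- v)); last ring.
  rewrite expfzDr ?oppr_eq0 ?oner_eq0//; ring.
rewrite addr0 expr2; apply: hassum_unique fs0 _.
apply: hassum_eq (hassum_prod tqq tqq) => -[u v] /=.
rewrite !exprzN_sqr (@exprzN1_even _ (u - v) (u + v) (- v)); last ring.
rewrite -[q * q]/(q ^ 2) !exprz_exp expfzDr ?oppr_eq0 ?oner_eq0//.
have E : q ^ ((u + v) * (u + v)) * q ^ ((u - v) * (u - v)) =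
    q ^ (2 * (u * u)) * q ^ (2 * (v * v)).
  by rewrite -!expfzDr//; congr (_ ^ _); ring.
by rewrite [RHS]mulrCA E; ring.
Qed.

End Theta.

(** * Growth and decay of the theta series *)

Section ThetaEstimates.
Context {R : realType}.
Implicit Types r : R.

(* The term of index [2 u] is dominated by the opposite of that of index
   [2 u - sgn u]. *)
Lemma thetaN_le1 r : 0 < r < 1 -> theta (- r) <= 1.
Proof.
move=> /andP[r0 r1]; have Nr0 : - r != 0 by rewrite oppr_eq0 gt_eqF.
have Nr1 : `|- r| < 1 by rewrite normrN gtr0_norm.
have [+ _] := hassum_theta Nr0 Nr1.
move=> /(hassum_split (fun v => 2 %| v)%Z)[s0 [s1 [fs0 fs1 ->]]].
pose e0 (u : int) := 2 * u.
(* The value 0 at [u = 0] is even, so the odd part of the series vanishes there and only the term 1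
   of index 0 is left. *)
pose e1 (u : int) := if 0 < u then 2 * u - 1 else if u < 0 then 2 * u + 1 else 0.
have e0_inj : injective e0 by move=> u v; rewrite /e0; lia.
have e1_inj : injective e1.
  move=> u v; rewrite /e1; case: (ltgtP u 0); case: (ltgtP v 0); lia.
have out0 v : ~ range e0 v -> (if (2 %| v)%Z then (- r) ^ (v * v) else 0) = 0.
  move=> ve; case: ifP => // /dvdzP[c cE]; exfalso; apply: ve; exists c => //.
  by rewrite /e0 cE mulrC.
have out1 v : ~ range e1 v -> (if (2 %| v)%Z then 0 else (- r) ^ (v * v)) = 0.
  move=> ve; case: ifP => // /negP nd; exfalso.
  have [[c cE]|[c cE]] := int_parity v; first by apply: nd; rewrite cE dvdz_mulr.
  apply: ve; have [c0|c0] := leP 0 c.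
    by exists (c + 1) => //; rewrite /e1 ifT; lia.
  by exists c => //; rewrite /e1 ifF ?ifT; lia.
have := hassumD ((hassum_inj s0 e0_inj out0).1 fs0) ((hassum_inj s1 e1_inj out1).1 fs1).
have one := @hassum_single R int 0 (fun u => if u == 0 then 1 else 0)
  (fun u => ifN_eq _ _).
rewrite eqxx in one => sm; apply: hassum_le _ sm one => u /=.
rewrite /e0 dvdz_mulr//=; case: ifP => [/dvdzP[c]|/negP odd_e1].
  rewrite /e1; case: (ltgtP u 0) => [||->]; try lia.
  by rewrite addr0 !mulr0 expr0z ?eqxx.
have [u0|u0] := eqVneq u 0; first by case: odd_e1; rewrite u0.
rewrite !exprzN_sqr exprzN1_double mul1r.
have -> : (-1) ^ e1 u = -1 :> R.
  have [[c cE]|[c ->]] := int_parity (e1 u); first by case: odd_e1; rewrite cE dvdz_mulr.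
  by rewrite expfzDr ?oppr_eq0 ?oner_eq0// exprzN1_double mul1r expr1z.
rewrite mulN1r subr_le0; apply: ler_wpiXz2l; rewrite ?ltW//.
- exact: sqr_ge0.
- exact: sqr_ge0.
- by rewrite /e1; case: (ltgtP u 0) u0 => //; nia.
Qed.

Lemma bernoulli_le (t : R) n : 0 <= t <= 1 -> 1 - n%:R * t <= (1 - t) ^+ n.
Proof.
move=> /andP[t0 t1]; elim: n => [|n IH]; first by rewrite mul0r subr0.
rewrite exprS; apply: le_trans (ler_wpM2l _ IH); last by rewrite subr_ge0.
have : 0 <= n%:R * t * t by rewrite !mulr_ge0.
rewrite -natr1; lra.
Qed.

Lemma hassum_ge_nat (f : int -> R) s c n : (forall m, 0 <= f m) -> hassum f s ->
  (forall i : nat, (i <= n)%N -> c <= f i) -> n.+1%:R * c <= s.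
Proof.
move=> f0 fs cf.
have : hassum (fun m : int => if 0 <= m <= n%:Z then c else 0) (n.+1%:R * c).
  elim: n {cf} => [|n IH].
    have := @hassum_single R int 0 (fun m => if 0 <= m <= 0 then c else 0).
    by rewrite lexx mul1r; apply=> m; rewrite -eq_le eq_sym => /negPf ->.
  have := @hassum_single R int n.+1 (fun m => if m == n.+1 then c else 0)
    (fun u => ifN_eq _ _).
  rewrite eqxx -natr1 mulrDl mul1r => /(hassumD IH); apply: hassum_eq => m /=.
  case: (ltgtP m n.+1) => h.
  - by rewrite addr0; congr (if _ then _ else _); lia.
  - by rewrite ifF ?ifF ?addr0//; lia.
  - by rewrite ifF ?ifT ?add0r//; lia.
move=> /hassum_le; apply; last exact: fs.
move=> m; case: ifP => // m0; have -> : m = `|m|%N by lia.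
by apply: cf; lia.
Qed.

(** With [t = 1 - r] and [x = sqrt (1 / (2 t))], Bernoulli makes every term of index [0 <= i <= x]
    at least [1 - x^2 t = 1 / 2]. There are more than [x] of them, so [s >= x / 2], and squaring
    gives [1 / (8 t)]. *)
Lemma hassum_sqr_ge r (f : int -> R) s : 0 < r < 1 -> (forall m, 0 <= f m) ->
  (forall i : nat, r ^+ (i * i) <= f i) -> hassum f s -> 1 <= 8 * (1 - r) * s ^+ 2.
Proof.
move=> /andP[r0 r1] f0 rf fs; set t := 1 - r; have t0 : 0 < t by rewrite subr_gt0.
have t1 : t <= 1 by rewrite /t; lra.
pose x := Num.sqrt (1 / (2 * t)).
have x2 : x ^+ 2 * (2 * t) = 1.
  have t2 : 0 < 2 * t by rewrite mulr_gt0.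
  by rewrite sqr_sqrtr ?divfK ?gt_eqF// divr_ge0// ltW.
have x0 : 0 <= x by exact: sqrtr_ge0.
have /andP[nx xn] := truncn_itv x0; set n := Num.truncn x in nx xn.
have : n.+1%:R * 2^-1 <= s.
  apply: hassum_ge_nat f0 fs _ => i ni; apply: le_trans (rf i).
  have -> : r = 1 - t by rewrite /t; lra.
  apply: le_trans (bernoulli_le _ _); last by rewrite ltW.
  have ix : i%:R <= x by apply: le_trans nx; rewrite ler_nat.
  have i2 : i%:R * i%:R <= x ^+ 2 by rewrite expr2 ler_pM.
  have := ler_wpM2r (ltW t0) i2; rewrite natrM; lra.
move=> ns; have xs : x / 2 <= s by lra.
have : (x / 2) ^+ 2 <= s ^+ 2 by rewrite !expr2 ler_pM//; lra.
move=> /(ler_wpM2l (ltW t0)); rewrite exprMn; lra.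
Qed.

Lemma theta_sqr_ge r : 0 < r < 1 -> 1 <= 8 * (1 - r) * theta r ^+ 2.
Proof.
move=> r01; have /andP[r0 r1] := r01.
have [fs _] := @hassum_theta R r (lt0r_neq0 r0) ltac:(by rewrite gtr0_norm).
by apply: hassum_sqr_ge fs => // m; rewrite exprz_ge0// ltW.
Qed.

Lemma psi_even q : psi (- q) = psi q :> R.
Proof.
congr (summability.sum _); apply/funext => v.
by rewrite -[- q]mulN1r expfzMl -triE mulrC [tri v * 2]mulrC exprzN1_double mulr1.
Qed.

Lemma psi_sqr_ge r : 0 < r < 1 -> 1 <= 8 * (1 - r) * psi r ^+ 2.
Proof.
move=> r01; have /andP[r0 r1] := r01.
have [fs _] := @hassum_psi R r (lt0r_neq0 r0) ltac:(by rewrite gtr0_norm).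
apply: hassum_sqr_ge fs => // [m|i]; first by rewrite exprz_ge0// ltW.
have vv : 0 <= i%:Z * (i%:Z - 1) by rewrite -triE; have := tri_ge0 i; lia.
rewrite exprnP; apply: (ler_wpiXz2l (ltW r0) (ltW r1)); [by []|exact: vv|].
by rewrite PoszM; lia.
Qed.

Lemma thetaN_decay N : exists2 C, 0 <= C &
  forall r, 0 < r < 1 -> theta (- r) ^+ 2 <= C * (1 - r) ^+ N.
Proof.
have theta0 r : 0 < r < 1 -> 0 < theta r.
  move=> r01; have /andP[r0 r1] := r01.
  have [fs _] := @hassum_theta R r (lt0r_neq0 r0) ltac:(by rewrite gtr0_norm).
  have th0 : 0 <= theta r by apply: hassum_ge0 fs => m; rewrite exprz_ge0// ltW.
  rewrite lt_neqAle th0 andbT.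
  by apply/eqP => th; have := theta_sqr_ge r01; rewrite -th expr0n mulr0 ler10.
have rr01 r : 0 < r < 1 -> 0 < r * r < 1.
  by move=> /andP[r0 r1]; rewrite mulr_gt0//= mulr_ilt1 ?ltW.
have mulN r : 0 < r < 1 -> theta r * theta (- r) = theta (- (r * r)) ^+ 2.
  by move=> /andP[r0 r1]; rewrite theta_mulN ?gt_eqF ?gtr0_norm.
(* The identity turns the exponent [N] into [2 N + 1]; [N + 1] is enough. *)
elim: N => [|N [C C0 IH]].
  (* [theta (- r)] is at most 1, and nonnegative because its product with [theta r > 0] is a
     square. *)
  exists 1 => // r r01; rewrite mul1r expr0 expr_le1// ?thetaN_le1//.
  by rewrite -(pmulr_rge0 _ (theta0 _ r01)) mulN// sqr_ge0.
exists (8 * C ^+ 2 * 4 ^+ N) => [|r r01]; first by rewrite !mulr_ge0 ?exprn_ge0.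
have /andP[r0 r1] := r01; set t := 1 - r; have t0 : 0 < t by rewrite subr_gt0.
have th2 := theta_sqr_ge r01; set a := theta r in th2; set b := theta (- r).
(* The induction hypothesis at [r * r], with [1 - r * r <= 2 * t]. *)
have ab : a * b <= C * (2 ^+ N * t ^+ N).
  rewrite mulN//; apply: le_trans (IH _ (rr01 _ r01)) _.
  by rewrite -exprMn; apply: ler_wpM2l => //; apply: lerXn2r; rewrite ?nnegrE /t; nra.
have ab0 : 0 <= a * b by rewrite mulN// sqr_ge0.
have tN1 : t ^+ N <= 1 by apply: exprn_ile1; rewrite /t; lra.
have tN0 : 0 <= t ^+ N by apply: exprn_ge0; lra.
have N4 : 4 ^+ N = 2 ^+ N * 2 ^+ N :> R by rewrite -exprMn; congr (_ ^+ _); ring.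
have N2 : 0 <= 2 ^+ N :> R by rewrite exprn_ge0.
have : (a * b) * (a * b) <= (C * (2 ^+ N * t ^+ N)) * (C * 2 ^+ N).
  apply: ler_pM => //; apply: le_trans ab _; apply: ler_wpM2l => //.
  by rewrite -[leRHS]mulr1 ler_wpM2l.
rewrite N4 [t ^+ _.+1]exprSr => /(ler_wpM2l (ltW t0)) le1.
(* The lower bound [1 <= 8 * t * a ^+ 2] turns the bound on [(a * b)^2] into one on [b ^+ 2] with an
   extra factor [t]. *)
have : b ^+ 2 * 1 <= b ^+ 2 * (8 * t * a ^+ 2) by apply: ler_wpM2l => //; exact: sqr_ge0.
by rewrite !expr2; lra.
Qed.

End ThetaEstimates.

(** * Asymptotics at -1 *)

Section MainTerm.
Context {R : realType}.
Implicit Types (p : bool) (l : nat) (m n u : int).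

(** Evaluated at [m = n - l] for [k = 2 l + p]. The value 0, for [k] even and [m] odd, is the
    vanishing case. *)
Definition main_sign p m : R :=
  if p || (2 %| m)%Z then (-1) ^ (m %/ 2)%Z else 0.

Lemma main_sign_even p u : main_sign p (2 * u) = (-1) ^ u.
Proof. by rewrite /main_sign dvdz_mulr// orbT mulKz. Qed.

Lemma main_sign_odd p u : main_sign p (2 * u + 1) = if p then (-1) ^ u else 0.
Proof.
rewrite /main_sign (_ : (2 %| _)%Z = false) ?orbF.
  by rewrite mulrC divzMDl// divz_small// addr0.
by apply/negP => /dvdzP[c]; lia.
Qed.

(** The factor [(-1) ^ u] is the one that cancels the sign of [q ^ (u * u)] in the [psi] branch, so
    that all terms add up with one sign. *)
Lemma main_sign_sub p m u : main_sign p (m - 2 * u) = (-1) ^ u * main_sign p m.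
Proof.
have N v : (-1) ^ (v - u) = (-1) ^ u * (-1) ^ v :> R.
  rewrite (@exprzN1_even _ (v - u) (u + v) (- u)); last ring.
  by rewrite expfzDr// oppr_eq0 oner_eq0.
have [[v ->]|[v ->]] := int_parity m.
  by rewrite -mulrBr !main_sign_even.
rewrite (_ : _ - 2 * u = 2 * (v - u) + 1); last ring.
by rewrite !main_sign_odd; case: p; rewrite ?mulr0.
Qed.

(** Absolute value of [gamma p n q] for [r = |q|] and [m = n]: the start of the induction on [l]. *)
Definition main_base p (r : R) m : R := if p then r ^ tri m else (m == 0)%:R.

Section FixedQ.
Variable q : R.
Hypothesis q_itv : -1 < q < 0.

Let q_neq0 : q != 0. Proof. by case/andP: q_itv => _ /lt_eqF ->. Qed.
Let normq : `|q| = - q. Proof. by case/andP: q_itv => _ /ltr0_norm. Qed.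
Let q_lt1 : `|q| < 1. Proof. by rewrite normq; case/andP: q_itv; lra. Qed.
Let r_gt0 : 0 < `|q|. Proof. by rewrite normr_gt0. Qed.
Let r_neq0 : `|q| != 0. Proof. by rewrite gt_eqF. Qed.
Let r_lt1 : `| `|q| | < 1. Proof. by rewrite normr_id. Qed.
Local Notation r := `|q|.
Local Notation T := (2 / (1 - `|q|)).

Let T_ge1 : 1 <= T.
Proof. by rewrite ler_pdivlMr ?subr_gt0// mul1r; have := r_gt0; lra. Qed.

Let T_ge0 : 0 <= T. Proof. exact: le_trans T_ge1. Qed.

(** For [p = 1], both [tri (2 * u)] and [tri (2 * u + 1)] have the parity of [u]. *)
Lemma gamma_base p n : gamma p n q = main_sign p n * main_base p r n.
Proof.
case: p; rewrite /main_base.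
  rewrite gamma1// (_ : q ^ _ = (- r) ^ tri n); last by rewrite normq opprK.
  rewrite -[- r]mulN1r expfzMl; congr (_ * _).
  have := triE n; have [[u ->]|[u ->]] := int_parity n => triu.
    rewrite main_sign_even; apply: (@exprzN1_even _ _ _ (u * u - u)).
    by apply: (mulIf (isT : 2 != 0 :> int)); rewrite triu; ring.
  rewrite main_sign_odd; apply: (@exprzN1_even _ _ _ (u * u)).
  by apply: (mulIf (isT : 2 != 0 :> int)); rewrite triu; ring.
rewrite gamma0//; case: eqP => [->|_]; last by rewrite mulr0.
by rewrite -[X in main_sign _ X](mulr0 2) main_sign_even mul1r.
Qed.

Lemma psi_ge0 : 0 <= psi q.
Proof.
have [+ _] := hassum_psi q_neq0 q_lt1; apply: hassum_ge0 => v.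
by rewrite -triE mulrC -exprz_exp exprz_ge0// -[q ^ 2]exprnP sqr_ge0.
Qed.

(* For [l = 0] and [p = 0] the base term is supported at 0, whence the restriction
   on [u] in the lower bound. *)
Lemma gamma_structure p l : exists G : int -> R,
  [/\ forall n, 0 <= G n <= T ^+ (l.*2 + p),
      forall n, `|gamma (l.*2 + p) n q - main_sign p (n - l%:Z) * G n|
        <= l%:R * `|theta q| * T ^+ (l.*2 + p)
    & forall n u, (0 < l)%N || (u == 0) ->
        psi q ^+ l * r ^ (u * u) * main_base p r (n - l%:Z) <= G (n + 2 * u)].
Proof.
elim: l => [|l [G [G0T errG lowG]]].
  exists (main_base p r); split=> [n|n|n u /= /eqP ->].
  - rewrite /main_base double0 add0n; case: p; rewrite ?expr1 ?expr0.
      rewrite exprz_ge0// (le_trans _ T_ge1)//.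
      rewrite -(expr0z r).
      by apply: (ler_wpiXz2l (normr_ge0 q) (ltW q_lt1)) => //; exact: tri_ge0.
    by case: eqP => _; rewrite lexx ler01.
  - by rewrite gamma_base subr0 subrr normr0 !mul0r.
  - by rewrite subr0 !mulr0 expr0 expr0z !mul1r ?addr0.
set k := (l.*2 + p)%N in G0T errG *.
have -> : (l.+1.*2 + p)%N = k.+2 by rewrite /k doubleS.
have normG n : `|G n| <= T ^+ k by case/andP: (G0T n) => G0 GT; rewrite ger0_norm.
have hH n := hassum_weighted r_neq0 r_lt1 (fun u => normG (n - 1 - 2 * u)) tri_le_sqr.
rewrite normr_id in hH.
(* The [psi] branch with signs removed: the new [G] is [psi q * H]. *)
pose H n := sval (cid2 (hH n)).
have HE n : hassum (fun u => r ^ (u * u) * G (n - 1 - 2 * u)) (H n).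
  by rewrite /H; case: cid2.
have HT n : `|H n| <= T ^+ k * T by rewrite /H; case: cid2.
have H0 n : 0 <= H n.
  apply: hassum_ge0 (HE n) => u; rewrite mulr_ge0 ?exprz_ge0//.
  by case/andP: (G0T (n - 1 - 2 * u)).
have [_ psiT] := hassum_psi q_neq0 q_lt1; rewrite ger0_norm ?psi_ge0// in psiT.
exists (fun n => psi q * H n); split=> [n|n|n u _].
- rewrite mulr_ge0 ?psi_ge0//= exprS ler_pM ?psi_ge0//.
  by rewrite exprSr -[H n]ger0_norm.
- have [A [B [AE BE ->]]] := gammaSS k n q_neq0 q_lt1.
  have [A' /hassum_unique/(_ AE) -> AT] :=
    hassum_weighted q_neq0 q_lt1
      (fun u => gamma_norm_le q_neq0 q_lt1 k (n - 2 * u)) tri_le_double.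
  pose c := main_sign p (n - l.+1%:Z).
  (* The previous error, signed so that [r ^ (u * u) * d u] is the difference between a term of [B]
     and its main part. *)
  pose d u := (-1) ^ u * (gamma k (n - 1 - 2 * u) q
    - main_sign p (n - 1 - 2 * u - l%:Z) * G (n - 1 - 2 * u)).
  have dle u : `|d u| <= l%:R * `|theta q| * T ^+ k.
    by rewrite normrM normrXz normrN1 exp1rz mul1r.
  have [D DE DT] := hassum_weighted r_neq0 r_lt1 dle tri_le_sqr.
  rewrite normr_id in DT.
  have BH : B - c * H n = D.
    apply: hassum_unique (hassumB BE (hassumZ c (HE n))) _.
    apply: hassum_eq DE => u; rewrite /d.
    rewrite (_ : n - 1 - 2 * u - l%:Z = n - l.+1%:Z - 2 * u); last by rewrite intS; ring.
    rewrite main_sign_sub -/c.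
    have -> : q ^ (u * u) = (-1) ^ u * r ^ (u * u).
      by rewrite -exprzN_sqr normq opprK.
    have := exprzN1_mulss R u.
    by move: ((-1) ^ u) => e ee; ring: ee.
  rewrite -/c (_ : _ - _ = theta q * A + psi q * D); last by rewrite -BH; ring.
  apply: le_trans (ler_normD _ _) _; rewrite !normrM (ger0_norm psi_ge0).
  (* The [theta] branch adds one unit of error, padded by a factor [T >= 1]; the [psi] branch
     carries over the [l] earlier ones. *)
  have le1 : `|theta q| * `|A| <= `|theta q| * (T ^+ k * T) * T.
    rewrite -mulrA ler_wpM2l// (le_trans AT)// ler_peMr// mulr_ge0// exprn_ge0//.
  have le2 : psi q * `|D| <= T * (l%:R * `|theta q| * T ^+ k * T).
    by rewrite ler_pM// psi_ge0.
  apply: le_trans (lerD le1 le2) _; rewrite !exprSr -natr1; lra.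
(* A single term of the series [H], that of index [u], suffices. The induction hypothesis is used
   with shift 0, which is allowed even for [l = 0]. *)
- have Gn0 v : 0 <= r ^ (v * v) * G (n + 2 * u - 1 - 2 * v).
    by rewrite mulr_ge0 ?exprz_ge0//; case/andP: (G0T (n + 2 * u - 1 - 2 * v)).
  have := hassum_term_le u Gn0 (HE (n + 2 * u)).
  rewrite (_ : n + 2 * u - 1 - 2 * u = n - 1); last ring.
  move=> /(ler_wpM2l psi_ge0); apply: le_trans.
  have := lowG (n - 1) 0; rewrite eqxx orbT => /(_ isT).
  rewrite !mulr0 addr0 expr0z mulr1.
  rewrite (_ : n - 1 - l%:Z = n - l.+1%:Z); last by rewrite intS; ring.
  move=> /(ler_wpM2l (exprz_ge0 (u * u) (normr_ge0 q)))/(ler_wpM2l psi_ge0).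
  by apply: le_trans; rewrite exprS le_eqVlt; apply/orP; left; apply/eqP; ring.
Qed.

End FixedQ.
End MainTerm.

(** * Passage to the limit *)

Section Limits.
Context {R : realType}.
Local Notation F := (within `]-1, 0[ (nbhs (-1 : R))).

Lemma near_right (P : R -> Prop) d : 0 < d ->
  (forall q, -1 < q < 0 -> 1 + q < d -> P q) -> \forall q \near F, P q.
Proof.
move=> d0 H; rewrite near_withinE; exists d => //= q qd.
rewrite in_itv/= => q01; apply: H => //.
have : `|-1 - q| < d by [].
by rewrite ltr_norml; case/andP: q01; lra.
Qed.

Lemma near_right_ex (P : R -> Prop) : (\forall q \near F, P q) ->
  exists q, P q.
Proof.
rewrite near_withinE => -[d /= d0 H]; pose e := Num.min d 1 / 2.
have ed : 0 < e < d by rewrite /e; case: (leP d 1); lra.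
have e1 : e < 1 by rewrite /e; case: (leP d 1); lra.
exists (-1 + e); apply: H => /=.
  by rewrite ltr_norml; lra.
by rewrite in_itv/=; lra.
Qed.

(** The square of the power of [2 / (1 - |q|)] costs [(1 + q)^(- 2 k)], so decay of order [2 k + 1]
    for the square of [theta] leaves one factor [1 + q]. *)
Lemma error_decay (p : bool) l : exists2 K, 0 <= K & forall q : R, -1 < q < 0 ->
  (l%:R * `|theta q| * (2 / (1 - `|q|)) ^+ (l.*2 + p)) ^+ 2 <= K * (1 + q).
Proof.
set k := (l.*2 + p)%N; have [C C0 HC] := @thetaN_decay R (k + k).+1.
exists (l%:R ^+ 2 * C * (2 ^+ k * 2 ^+ k)) => [|q /andP[q1 q0]].
  by rewrite !mulr_ge0 ?exprn_ge0.
have Nq : 0 < - q < 1 by lra.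
rewrite (ltr0_norm q0) opprK; have := HC _ Nq; rewrite !opprK; set t := 1 + q => th.
have t0 : 0 < t by rewrite /t; lra.
have tk : t ^+ k != 0 by rewrite expf_neq0// gt_eqF.
rewrite exprMn exprMn real_normK ?num_real// expr_div_n exprMn exprVn -mulrA -mulrA -mulrA.
apply: ler_wpM2l; first exact: sqr_ge0.
have -> : C * (2 ^+ k * 2 ^+ k * t) = C * t ^+ (k + k).+1 * ((2 ^+ k) ^+ 2 / t ^+ k ^+ 2).
  by rewrite exprSr exprD; field.
by apply: ler_wpM2r => //; rewrite divr_ge0// ?sqr_ge0.
Qed.

Lemma gamma_vanishes (p : bool) l n : @main_sign R p (n - l%:Z) = 0 ->
  gamma (l.*2 + p) n q @[q --> F] --> (0 : R).
Proof.
move=> s0; have [K K0 HK] := error_decay p l.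
(* [K + 1] avoids dividing by zero; the squared error is then below [e ^+ 2]. *)
apply/cvgrPdist_lt => e e0; apply: (@near_right _ (e ^+ 2 / (K + 1))).
  by rewrite divr_gt0 ?exprn_gt0//; lra.
move=> q q01; rewrite ltr_pdivlMr; last by lra.
move=> qe; rewrite sub0r normrN.
have [G [_ + _]] := gamma_structure q01 p l => /(_ n); rewrite s0 mul0r subr0.
move=> /le_lt_trans; apply; rewrite ltNge; apply/negP => /(lerXn2r 2).
rewrite !nnegrE => /(_ (ltW e0)).
have := HK q q01; set E := _ * _ * _ => EK.
have E0 : 0 <= E.
  rewrite /E !mulr_ge0// exprn_ge0// divr_ge0// subr_ge0 ltr0_norm; lra.
by move=> /(_ E0); lra.
Qed.

Lemma gamma_diverges (p : bool) l n : (0 < l)%N -> @main_sign R p (n - l%:Z) != 0 ->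
  main_sign p (n - l%:Z) * gamma (l.*2 + p) n q @[q --> F] --> +oo.
Proof.
move=> l0 s0; have [K K0 HK] := error_decay p l.
set s := main_sign p (n - l%:Z).
have ss : s * s = 1.
  move: s0; rewrite -/s /s /main_sign; case: ifP; rewrite ?eqxx// => _ _.
  exact: exprzN1_mulss.
(* The exponent [M] must not depend on [q]. For [p = 1] it is [tri (n - l)], with no shift; for
   [p = 0] the nonzero sign forces [n - l = 2 u], and [n] is reached from [l] by the shift [u]. *)
have [M M0 HM] : exists2 M : int, 0 <= M &
    forall q : R, -1 < q < 0 -> forall G : int -> R,
    (forall n u, (0 < l)%N || (u == 0) ->
        psi q ^+ l * `|q| ^ (u * u) * main_base p `|q| (n - l%:Z) <= G (n + 2 * u)) ->
    psi q ^+ l * `|q| ^ M <= G n.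
  case: p @s s0 ss {HK} => s s0 ss.
    exists (tri (n - l%:Z)) => [|q q01 G /(_ n 0)]; first exact: tri_ge0.
    by rewrite l0 /main_base !mulr0 addr0 expr0z mulr1 => /(_ isT).
  have [[u uE]|[u uE]] := int_parity (n - l%:Z); last first.
    by move: s0; rewrite uE main_sign_odd eqxx.
  exists (u * u) => [|q q01 G /(_ l%:Z u)]; first exact: sqr_ge0.
  rewrite l0 /main_base subrr eqxx mulr1 => /(_ isT).
  by rewrite -uE addrC subrK.
pose c : R := 2^-1 ^ M; have c0 : 0 < c by rewrite exprz_gt0// invr_gt0.
(* [X * c = |A| + 1 + c] leaves room for an error of 1, and [X >= 1] lets [X <= psi q] pass to the
   power [l]. *)
apply/cvgryPge => A; pose X := (`|A| + 1) / c + 1.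
have X1 : 1 <= X by rewrite lerDr divr_ge0// ltW.
have X8 : 0 < 8 * X ^+ 2 by rewrite mulr_gt0// exprn_gt0//; lra.
(* The three thresholds ensure [|q| >= 1 / 2], error at most 1, and [psi q >= X], in this order. *)
apply: (@near_right _ (Num.min 2^-1 (Num.min (K + 1)^-1 (8 * X ^+ 2)^-1))).
  by rewrite !lt_min !invr_gt0 X8 ltr0n/= andbT; lra.
move=> q q01; rewrite !lt_min => /and3P[th tK tX].
have t0 : 0 < 1 + q by lra.
have Nq : 0 < - q < 1 by lra.
have [G [G0 err low]] := gamma_structure q01 p l.
have GM := HM q q01 G low; have {err} := err n.
have := HK q q01; set E := _ * _ * _ => EK.
have E0 : 0 <= E.
  rewrite /E !mulr_ge0// exprn_ge0// divr_ge0// subr_ge0 ltr0_norm; lra.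
have E1 : E <= 1.
  rewrite -(@expr_le1 _ 2)//; apply: le_trans EK _.
  move: tK; rewrite -[_^-1]mul1r ltr_pdivlMr; lra.
have psi2 : 1 <= 8 * (1 + q) * psi q ^+ 2.
  by have := psi_sqr_ge Nq; rewrite psi_even opprK.
have psi0 := psi_ge0 q01.
have psiX : X <= psi q.
  rewrite leNgt; apply/negP => pX.
  have : psi q ^+ 2 <= X ^+ 2 by rewrite !expr2 ler_pM// ltW.
  move=> /(ler_wpM2l (ltW t0)) le1.
  move: tX; rewrite -[_^-1]mul1r ltr_pdivlMr//; lra.
have psil : X <= psi q ^+ l.
  apply: (le_trans psiX); rewrite -[leLHS]expr1; apply: ler_weXn2l => //.
  exact: (le_trans X1).
have cq : c <= `|q| ^ M.
  rewrite /c; case: (M) M0 => // m _; rewrite -!exprnP lerXn2r ?nnegrE ?invr_ge0//.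
  by rewrite ltr0_norm; lra.
have : X * c <= psi q ^+ l * `|q| ^ M by rewrite ler_pM//; lra.
rewrite /X mulrDl mul1r divfK ?gt_eqF// => XG.
rewrite -/s; set g := gamma _ _ _ => err.
have : `|s * g - G n| <= E.
  have -> : s * g - G n = s * (g - s * G n) by rewrite mulrBr mulrA ss mul1r.
  suff -> : `|s * (g - s * G n)| = `|g - s * G n| by [].
  have s1 : `|s| = 1.
    by apply/eqP; rewrite -(@pexpr_eq1 _ _ 2)// expr2 -normrM ss normr1.
  by rewrite normrM s1 mul1r.
rewrite ler_norml; have := ler_norm A; lra.
Qed.

End Limits.

Unset Implicit Arguments.
Set Strict Implicit.

Theorem theorem2 (R : realType) (k : nat) (n : int)
    (hk : (3 <= k)%N) (hn : 0 <= n <= k%:Z - 1) :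
  let F := within `]-1, 0[ (nbhs (-1 : R)) in
  let vanishing := ~~ odd k /\ (k%:Z - 2 * n = 2 %[mod 4])%Z in
  [/\ gamma k n q @[q --> F] --> (0 : R) <-> vanishing,
      ~ vanishing -> `|gamma k n q| @[q --> F] --> +oo
    & forall k' n' : int,
        [\/ k%:Z = 4 * k' /\ n = 2 * n',
            k%:Z = 4 * k' + 2 /\ n = 2 * n' + 1,
            k%:Z = 4 * k' + 1 /\ (n = 2 * n' \/ n = 2 * n' + 1)
          | k%:Z = 4 * k' - 1 /\ (n = 2 * n' \/ n = 2 * n' - 1)] ->
        (-1) ^ (k' - n') * gamma k n q @[q --> F] --> +oo].
Proof.
move=> F vanishing.
have kE : (k./2.*2 + odd k)%N = k by rewrite addnC odd_double_half.
have l0 : (0 < k./2)%N by case: k hk {hn F vanishing kE} => [|[|]].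
set s : R := main_sign (odd k) (n - k./2%:Z).
have kZ : k%:Z = 2 * k./2%:Z + odd k by lia.
(* For [k = 2 l], the congruence [k - 2 n = 2] modulo 4 says that [n - l] is odd. *)
have sE : vanishing <-> s = 0.
  rewrite /vanishing /s; split.
    move=> [/negPf kodd /eqP]; rewrite eqz_mod_dvd kodd => /dvdzP[c cE].
    rewrite kodd in kZ.
    rewrite (_ : n - k./2%:Z = 2 * (- c - 1) + 1) ?main_sign_odd//; lia.
  have [[u uE]|[u uE]] := int_parity (n - k./2%:Z); rewrite uE.
    by move=> /eqP; rewrite main_sign_even expfz_eq0 oppr_eq0 oner_eq0 andbF.
  rewrite main_sign_odd; case: (odd k) kZ => kZ => [/eqP|_].
    by rewrite expfz_eq0 oppr_eq0 oner_eq0 andbF.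
  split=> //; apply/eqP; rewrite eqz_mod_dvd; apply/dvdzP; exists (- u - 1); lia.
have div : s != 0 -> s * gamma k n q @[q --> F] --> +oo.
  by move=> s0; have := @gamma_diverges R (odd k) k./2 n l0 s0; rewrite kE.
have absdiv : s != 0 -> `|gamma k n q| @[q --> F] --> +oo.
  move=> s0; apply/cvgryPge => A; have /cvgryPge/(_ A) := div s0.
  apply: filterS => q /le_trans; apply; apply: le_trans (ler_norm _) _.
  rewrite normrM ler_piMl// /s /main_sign; case: ifP; rewrite ?normr0//.
  by rewrite normrXz normrN1 exp1rz.
split.
- rewrite sE; split=> [g0|/gamma_vanishes]; last by rewrite kE.
  (* Otherwise some [q] would have [|gamma k n q|] both at least 1 and below 1. *)
  apply/eqP/negP => /negP/absdiv/cvgryPge/(_ 1) g1.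
  have /cvgrPdist_lt/(_ 1 ltr01) g01 := g0.
  have [q] := near_right_ex (filterI g1 g01).
  by rewrite /= sub0r normrN => -[le1 /(le_lt_trans le1)]; rewrite ltxx.
- by move=> nv; apply: absdiv; apply/eqP => /sE.
move=> k' n' H; suff sn : s = (-1) ^ (k' - n') by rewrite -sn; apply: div;
  rewrite sn expfz_neq0// oppr_eq0 oner_eq0.
(* In all cases below, [n - k./2] is [2 (n' - k')] or, only for odd [k], [2 (n' - k') + 1]; the sign
   depends on the parity of [n' - k'] alone. *)
have E (a : int) : (-1) ^ (k' - n') = (-1) ^ (n' - k' + 2 * a) :> R.
  by rewrite (@exprzN1_even _ _ (n' - k' + 2 * a) (k' - n' - a))//; ring.
rewrite /s; case: H => [[kk nn]|[kk nn]|[kk [nn|nn]]|[kk [nn|nn]]].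
- rewrite (_ : n - _ = 2 * (n' - k')) ?main_sign_even ?(E 0) ?mulr0 ?addr0//; lia.
- rewrite (_ : n - _ = 2 * (n' - k')) ?main_sign_even ?(E 0) ?mulr0 ?addr0//; lia.
- rewrite (_ : n - _ = 2 * (n' - k')) ?main_sign_even ?(E 0) ?mulr0 ?addr0//; lia.
- rewrite (_ : n - _ = 2 * (n' - k') + 1) ?main_sign_odd ?(E 0) ?mulr0 ?addr0//; last lia.
  by have -> : odd k by lia.
- rewrite (_ : n - _ = 2 * (n' - k') + 1) ?main_sign_odd ?(E 0) ?mulr0 ?addr0//; last lia.
  by have -> : odd k by lia.
- rewrite (_ : n - _ = 2 * (n' - k')) ?main_sign_even ?(E 0) ?mulr0 ?addr0//; lia.
Qed.
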